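(* Let $p\ge 5$ be a prime and let $r$ be an integer with $1\le r\le p-1$ that is a quadratic non-residue modulo $p$. Then for all integers $n\ge 0$ and all integers $k\ge j\ge 0$, \[ a_{p(k-j)+(p-1),\;pk+(p-2)}(pn+r)\equiv 0 \pmod p. \]
   Context: For positive integers $r,s$, $a_{r,s}(n)$ denotes the number of multicolored partitions of $n$ in which each even part may appear in one of $r$ colors and each odd part may appear in one of $s$ colors (copies of the same part size in different colors are distinct), with $a_{r,s}(0)=1$. Equivalently, for $|q|<1$, $\sum_{n\ge0}a_{r,s}(n)q^n = f_2^{s-r}/f_1^{s}$, where $f_m=\prod_{i\ge1}(1-q^{mi})$. *)

(* Defs.v *)
From mathcomp Require Import all_boot.

Set Implicit Arguments.
Unset Strict Implicit.
Unset Printing Implicit Defensive.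

Definition ncolors (r s i : nat) : nat := if odd i then s else r.

(* The parts available for a partition of n: an index i : 'I_n stands for the
   part size i.+1, so the sizes range over 1, ..., n. *)
Definition colored_part (r s n : nat) : finType :=
  {i : 'I_n & 'I_(ncolors r s i.+1)}.

Definition part_size (r s n : nat) (u : colored_part r s n) : nat :=
  (tag u).+1.

(* A multicolored partition is a multiset of colored parts, given by its
   multiplicity function. In a partition of n all part sizes and all
   multiplicities are at most n, so these bounds lose nothing. *)
Definition multicolored_partitions (r s n : nat) :
    {set {ffun colored_part r s n -> 'I_n.+1}} :=
  [set m : {ffun colored_part r s n -> 'I_n.+1} |
    \sum_(u : colored_part r s n) part_size u * m u == n].

Definition a (r s n : nat) : nat := #|multicolored_partitions r s n|.

Lemma a0 (r s : nat) : a r s 0 = 1.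
Proof.
have E (u : colored_part r s 0) : False by case: u => - [].
rewrite /a (_ : multicolored_partitions r s 0 = [set [ffun=> ord0]]) ?cards1 //.
apply/setP=> m; rewrite !inE big1; last by move=> u; case: (E u).
by rewrite eqxx; apply/esym/eqP/ffunP => u; case: (E u).
Qed.

Definition quadratic_residue (p r : nat) : Prop :=
  exists x : nat, x ^ 2 = r %[mod p].

(* Main.v *)
(** The generating function of a_{r,s} is the product over i of
    (1 - X^i)^(- ncolors i).  For the given numbers of colors, multiplying it
    by the p-th power of the product of the (1 - X^i)^(c_i), for suitable
    c_i, leaves f_1^2 / f_2, which by Gauss equals the sum over all integers d
    of (-1)^d X^(d^2).  Modulo p a p-th power only involves powers of X^p, so
    the coefficients at exponents congruent to a non-residue vanish.

    Gauss's identity comes from the q-binomial theorem for the product of the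
    y + x q^i with i < 2n, at q = X^2, x = -1, y = X^(2n-1).  Power series are
    replaced by polynomials compared up to degree N. *)

Require Import Defs.
From mathcomp Require Import all_boot.
From mathcomp Require Import all_order all_algebra zify ring.

Set Implicit Arguments.
Unset Strict Implicit.
Unset Printing Implicit Defensive.

Import GRing.Theory.
Local Open Scope ring_scope.

(** * Congruence of polynomials modulo a power of X *)

Section EqmodX.

Variable R : comNzRingType.
Implicit Types (P Q : {poly R}) (N : nat).

Definition eqmodX N P Q := forall i, (i < N)%N -> P`_i = Q`_i.

Lemma eqmodX_refl N P : eqmodX N P P.
Proof. by []. Qed.

Lemma eqmodX_sym N P Q : eqmodX N P Q -> eqmodX N Q P.
Proof. by move=> h i /h. Qed.

Lemma eqmodX_trans N P Q U : eqmodX N P Q -> eqmodX N Q U -> eqmodX N P U.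
Proof. by move=> h1 h2 i lt_iN; rewrite h1 ?h2. Qed.

Lemma eqmodXM N P Q P' Q' :
  eqmodX N P P' -> eqmodX N Q Q' -> eqmodX N (P * Q) (P' * Q').
Proof.
move=> hP hQ i lt_iN; rewrite !coefM; apply: eq_bigr => j _.
by have := ltn_ord j => lt_ji; rewrite hP ?hQ //; lia.
Qed.

Lemma eqmodX_prod N (I : Type) (s : seq I) (C : pred I) (F G : I -> {poly R}) :
    (forall i, C i -> eqmodX N (F i) (G i)) ->
  eqmodX N (\prod_(i <- s | C i) F i) (\prod_(i <- s | C i) G i).
Proof. by move=> h; elim/big_ind2: _ => // *; apply: eqmodXM. Qed.

Lemma eqmodX_sum N (I : Type) (s : seq I) (C : pred I) (F G : I -> {poly R}) :
    (forall i, C i -> eqmodX N (F i) (G i)) ->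
  eqmodX N (\sum_(i <- s | C i) F i) (\sum_(i <- s | C i) G i).
Proof.
by move=> h i lt_iN; rewrite !coef_sum; apply: eq_bigr => j /h ->.
Qed.

Lemma eqmodX_exp N P Q k : eqmodX N P Q -> eqmodX N (P ^+ k) (Q ^+ k).
Proof. by move=> h; elim: k => // k IH; rewrite !exprS; apply: eqmodXM. Qed.

Lemma eqmodX_1subXn N k : (N <= k)%N -> eqmodX N (1 - 'X^k) 1.
Proof.
by move=> le_Nk i lt_iN; rewrite coefB coefXn ltn_eqF ?subr0 //; lia.
Qed.

Lemma eqmodX_XnM N k P Q : (N <= k)%N -> eqmodX N ('X^k * P) ('X^k * Q).
Proof. by move=> le_Nk i lt_iN; rewrite !coefXnM (leq_trans lt_iN). Qed.

(** A truncated inverse of [1 - 'X^k], exact below degree [N] when [k > 0]. *)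
Definition geomX N k : {poly R} := \sum_(m < N) 'X^(k * m).

Lemma eqmodX_geom N k : (0 < k)%N -> eqmodX N ((1 - 'X^k) * geomX N k) 1.
Proof.
move=> k_gt0; rewrite /geomX.
have -> : (1 - 'X^k) * (\sum_(m < N) 'X^(k * m)) = 1 - 'X^(k * N) :> {poly R}.
  under eq_bigr do rewrite exprM.
  have := subrX1 ('X^k : {poly R}) N; rewrite exprM => h.
  by rewrite -[1 - _ ^+ N]opprB h -mulNr opprB.
by apply: eqmodX_1subXn; rewrite leq_pmull.
Qed.

End EqmodX.

(** * Gaussian binomial coefficients *)

Section QBinomial.

Variable R : comNzRingType.
Implicit Types q x y : R.

Fixpoint qbin q (m k : nat) : R :=
  match m, k with
  | _, 0 => 1
  | 0, _.+1 => 0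
  | m'.+1, k'.+1 => qbin q m' k' + q ^+ k'.+1 * qbin q m' k'.+1
  end.

Definition qpoch q (n : nat) : R := \prod_(i < n) (1 - q ^+ i.+1).

Lemma qbinn0 q m : qbin q m 0 = 1.
Proof. by case: m. Qed.

Lemma qbin_small q m k : (m < k)%N -> qbin q m k = 0.
Proof.
elim: m k => [|m IH] [|k] //= lt_mk.
by rewrite !IH ?mulr0 ?addr0 //; lia.
Qed.

Lemma qpochS q n : qpoch q n.+1 = qpoch q n * (1 - q ^+ n.+1).
Proof. by rewrite /qpoch big_ord_recr. Qed.

(** The quotient formula for Gaussian binomials with denominators cleared, as [R] is an arbitrary
    commutative ring. *)
Lemma qbin_qpoch q m k : (k <= m)%N ->
  qbin q m k * qpoch q k * qpoch q (m - k) = qpoch q m.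
Proof.
elim: m k => [|m IH] [|k] //=; rewrite ?subn0.
- by rewrite /qpoch big_ord0 !mulr1.
- by rewrite {1}/qpoch big_ord0 !mul1r.
rewrite ltnS subSS => le_km; have := IH k le_km.
case: (ltngtP k m) le_km => // [lt_km|->] _ IHk.
  have := IH k.+1 lt_km; have -> : (m - k = (m - k.+1).+1)%N by lia.
  move: IHk; have -> : (m - k = (m - k.+1).+1)%N by lia.
  rewrite !qpochS => h1 h2.
  set A := qbin q m k in h1 *; set B := qbin q m k.+1 in h2 *.
  rewrite !mulrDl.
  have -> : A * (qpoch q k * (1 - q ^+ k.+1)) *
            (qpoch q (m - k.+1) * (1 - q ^+ (m - k.+1).+1)) =
            (1 - q ^+ k.+1) * (A * qpoch q k *
            (qpoch q (m - k.+1) * (1 - q ^+ (m - k.+1).+1))) by ring.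
  have -> : q ^+ k.+1 * B * (qpoch q k * (1 - q ^+ k.+1)) *
            (qpoch q (m - k.+1) * (1 - q ^+ (m - k.+1).+1)) =
            q ^+ k.+1 * (1 - q ^+ (m - k.+1).+1) *
            (B * (qpoch q k * (1 - q ^+ k.+1)) * qpoch q (m - k.+1)) by ring.
  (* What remains is [1 - q^(m+1) = (1 - q^(k+1)) + q^(k+1) (1 - q^(m-k))]. *)
  rewrite h1 h2; have -> : (m.+1 = k.+1 + (m - k.+1).+1)%N by lia.
  by rewrite exprD; ring.
move: IHk; rewrite subnn (@qbin_small q m m.+1) // qpochS => h.
by rewrite mulr0 addr0 -[in RHS]h; ring.
Qed.

(** Induction on [m] for all [x]: the factors after the first form the product for [x * q], and the
    Pascal rule recombines the terms. *)
Lemma qbinomial_theorem q x y m :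
  \prod_(i < m) (y + x * q ^+ i) =
  \sum_(k < m.+1) q ^+ 'C(k, 2) * qbin q m k * x ^+ k * y ^+ (m - k).
Proof.
elim: m x => [|m IH] x.
  by rewrite big_ord0 big_ord1 /= !mulr1.
rewrite big_ord_recl expr0 mulr1.
under eq_bigr do rewrite lift0 exprS mulrA.
rewrite IH mulrDl [RHS]big_ord_recl.
under [X in _ = _ + X]eq_bigr do
  rewrite lift0 subSS /= mulrDr 2!mulrDl binS bin1 exprD.
rewrite big_split /= subn0 !mulr1 mul1r addrCA addrC; congr (_ + _); last first.
  by rewrite mulr_sumr; apply: eq_bigr => k _; rewrite exprMn exprS; ring.
rewrite big_ord_recl [X in _ = _ + X]big_ord_recr /= (@qbin_small q m m.+1) //.
rewrite !mulr0 !mul0r addr0 qbinn0 subn0 !mul1r mulrDr -exprS.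
congr (_ + _); rewrite mulr_sumr; apply: eq_bigr => k _.
rewrite [bump _ _]add1n exprMn binS bin1 exprD.
have -> : (m - k = (m - k.+1).+1)%N by have := ltn_ord k; lia.
by rewrite [y ^+ _.+1]exprS; ring.
Qed.

End QBinomial.

(** * Gauss's identity *)

Section Gauss.

Variable R : comNzRingType.
Implicit Types n N k : nat.

Definition odd_prod n : {poly R} := \prod_(i < n) (1 - 'X^(i.*2.+1)).

(* The truncated expression is |k - n|. *)
Definition dist_sq n k := (((k - n) + (n - k)) ^ 2)%N.

Lemma prod_opp_even_Xn n :
  \prod_(i < n) (- 'X^(i.*2)) = (-1) ^+ n * 'X^(n * n.-1) :> {poly R}.
Proof.
elim: n => [|n IH]; first by rewrite big_ord0 mulr1.
rewrite big_ord_recr /= IH.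
have -> : (n.+1 * n = n * n.-1 + n.*2)%N by nia.
by rewrite exprD exprS; ring.
Qed.

(** Completes the square in the exponent of the [k]-th q-binomial term; the part free of [k] is the
    power of ['X] that factors out of the product. *)
Lemma dist_sqE n k : (0 < n)%N -> (k <= n.*2)%N ->
  (2 * 'C(k, 2) + n.*2.-1 * (n.*2 - k) =
   dist_sq n k + (n * n.-1 + n * n.*2.-1))%N.
Proof.
move=> n_gt0 le_k; have -> : (2 * 'C(k, 2) = k * k.-1)%N.
  by rewrite mul2n bin2 halfK oddM; case: k {le_k} => //= k; rewrite andNb subn0.
rewrite /dist_sq; case: n n_gt0 le_k => // n _; rewrite doubleS /= => le_k.
case: k le_k => [|k] le_k; first by rewrite sub0n !subn0 add0n -muln2; ring.
rewrite !subSS /=; case: (leqP k n) => [le_kn | /ltnW le_nk].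
  have [d ->] : exists d, n = (k + d)%N by exists (n - k)%N; lia.
  have -> : (k - (k + d) = 0)%N by lia.
  have -> : (k + d - k = d)%N by lia.
  have -> : ((k + d).*2.+1 - k = k + d.*2.+1)%N by lia.
  by rewrite -!muln2; ring.
have [d ek] : exists d, k = (n + d)%N by exists (k - n)%N; lia.
have [c en] : exists c, (n.+1 = d + c)%N by exists (n.+1 - d)%N; lia.
have -> : (n.*2.+1 - k = c)%N by lia.
have -> : (n - k = 0)%N by lia.
have -> : (k - n = d)%N by lia.
rewrite addn0; nia.
Qed.

(** A finite form of Gauss's identity: the halves [i < n] and [i >= n] of the q-binomial product
    each equal [odd_prod n] up to sign and a power of ['X]. *)
Lemma odd_prod_sqr n : (0 < n)%N ->
  odd_prod n ^+ 2 =
  \sum_(k < n.*2.+1) (-1) ^+ (n + k) * 'X^(dist_sq n k) * qbin 'X^2 n.*2 k.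
Proof.
move=> n_gt0.
have := @qbinomial_theorem {poly R} 'X^2 (-1) 'X^(n.*2.-1) (n + n)%N.
rewrite big_split_ord /= addnn.
have -> : \prod_(i < n) ('X^(n.*2.-1) + -1 * 'X^2 ^+ i) =
          (-1) ^+ n * 'X^(n * n.-1) * odd_prod n :> {poly R}.
  (* Since [X^(2n-1) - X^(2i) = - X^(2i) (1 - X^(2(n-1-i)+1))], the odd factors occur in reverse
     order. *)
  rewrite -prod_opp_even_Xn /odd_prod [X in _ * X](reindex_inj rev_ord_inj).
  rewrite -big_split; apply: eq_bigr => i _ /=.
  have -> : (n.*2.-1 = i.*2 + (n - i.+1).*2.+1)%N.
    by have := ltn_ord i; lia.
  by rewrite -exprM mul2n exprD; ring.
have -> : \prod_(i < n) ('X^(n.*2.-1) + -1 * 'X^2 ^+ (n + i)) =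
          'X^(n * n.*2.-1) * odd_prod n :> {poly R}.
  have -> : 'X^(n * n.*2.-1) = \prod_(i < n) 'X^(n.*2.-1) :> {poly R}.
    by rewrite prodr_const card_ord -exprM mulnC.
  rewrite -big_split; apply: eq_bigr => i _ /=.
  have e : (2 * (n + i) = n.*2.-1 + i.*2.+1)%N by lia.
  by rewrite -exprM e exprD; ring.
move=> h; have rX : GRing.rreg ('X^(n * n.-1 + n * n.*2.-1) : {poly R}).
  exact/monic_rreg/monicXn.
apply: rX; apply: (@lreg_sign _ n).
transitivity ((-1) ^+ n * 'X^(n * n.-1) * odd_prod n *
              ('X^(n * n.*2.-1) * odd_prod n)); first by rewrite exprD; ring.
rewrite h mulr_suml mulr_sumr; apply: eq_bigr => k _.
have le_k : (k <= n.*2)%N by rewrite -ltnS ltn_ord.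
rewrite -!exprM.
transitivity ((-1) ^+ k * ('X^(2 * 'C(k, 2)) * 'X^(n.*2.-1 * (n.*2 - k))) *
              qbin 'X^2 n.*2 k : {poly R}); first by ring.
rewrite -exprD dist_sqE // exprD [(-1) ^+ (n + k)]exprD.
transitivity ((-1) ^+ n ^+ 2 * ((-1) ^+ k * ('X^(dist_sq n k) *
  'X^(n * n.-1 + n * n.*2.-1)) * qbin 'X^2 n.*2 k) : {poly R}).
  by rewrite sqrr_sign mul1r.
by ring.
Qed.

Lemma eqmodX_qpoch N m n : (N <= m)%N -> (m <= n)%N ->
  eqmodX N (qpoch 'X^2 m) (qpoch ('X^2 : {poly R}) n).
Proof.
move=> le_Nm; elim: n => [|n IH]; first by rewrite leqn0 => /eqP ->.
rewrite leq_eqVlt => /orP [/eqP -> //|lt_mn].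
rewrite qpochS -[X in eqmodX _ X _]mulr1; apply: eqmodXM; first exact: IH.
by apply: eqmodX_sym; rewrite -exprM; apply: eqmodX_1subXn; lia.
Qed.

Lemma qpoch_coef0 n : (qpoch ('X^2 : {poly R}) n)`_0 = 1.
Proof.
elim: n => [|n IH]; first by rewrite /qpoch big_ord0 coef1.
by rewrite qpochS coef0M IH -exprM coefB coef1 coefXn subr0 mulr1.
Qed.

(** [F] is invertible as a power series; strong induction on the degree replaces the inverse. *)
Lemma eqmodX_mulI N (F P Q : {poly R}) :
  F`_0 = 1 -> eqmodX N (F * P) (F * Q) -> eqmodX N P Q.
Proof.
move=> F0 h i; elim/ltn_ind: i => i IH lt_iN; have := h i lt_iN.
rewrite !coefM !big_ord_recl /= subn0 F0 !mul1r.
rewrite (eq_bigr (fun j : 'I_i => F`_(lift ord0 j) * Q`_(i - lift ord0 j))).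
  by move/addIr.
by move=> j _; rewrite IH //= ?[bump _ _]add1n; have := ltn_ord j; lia.
Qed.

(** As [k], [2n - k], [n] and [2n] are all at least [N], every [qpoch] in the quotient formula
    agrees with [qpoch 'X^2 n] below degree [N], and one copy cancels. *)
Lemma eqmodX_qbin_qpoch N n k : (N <= k)%N -> (N + k <= n.*2)%N -> (N <= n)%N ->
  eqmodX N (qbin 'X^2 n.*2 k * qpoch ('X^2 : {poly R}) n) 1.
Proof.
move=> le_Nk le_k le_Nn.
apply: (eqmodX_mulI (qpoch_coef0 n)); rewrite mulr1.
have le_kn : (k <= n.*2)%N by lia.
have qE m : (N <= m)%N -> eqmodX N (qpoch 'X^2 n) (qpoch ('X^2 : {poly R}) m).
  move=> le_Nm; case: (leqP n m) => [|/ltnW] le_mn; first exact: eqmodX_qpoch.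
  exact/eqmodX_sym/eqmodX_qpoch.
apply: eqmodX_trans (eqmodX_sym (qE n.*2 _)); last by lia.
rewrite -(@qbin_qpoch {poly R} 'X^2 n.*2 k) // mulrCA -mulrA.
apply: eqmodXM; first exact: eqmodX_refl.
by apply: eqmodXM; apply: qE; lia.
Qed.

Lemma eqmodX_gauss N :
  eqmodX N (odd_prod N.*2 ^+ 2 * qpoch 'X^2 N.*2)
    (\sum_(k < N.*2.*2.+1) (-1) ^+ (N.*2 + k) * 'X^(dist_sq N.*2 k)).
Proof.
have [-> //|N_gt0] := posnP N.
rewrite odd_prod_sqr ?double_gt0 // mulr_suml; apply: eqmodX_sum => k _.
rewrite -2!mulrA; apply: eqmodXM; first exact: eqmodX_refl.
rewrite -mulrA -[X in eqmodX _ _ X]mulr1.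
(* Only terms with [|k - 2N| < N] matter; for them [k] and [4N - k] are at least [N], which is why
   [n = 2N] is taken. *)
case: (leqP N (dist_sq N.*2 k)) => [|lt_d]; first exact: eqmodX_XnM.
apply: eqmodXM; first exact: eqmodX_refl.
have := ltn_ord k => lt_k.
by apply: eqmodX_qbin_qpoch; move: lt_d; rewrite /dist_sq; nia.
Qed.

(** The exponent of [1 - X^i] in [f_1^2 / f_2]. *)
Definition gauss_exp i : nat := if odd i then 2 else 1.

Lemma prod_gauss_exp n :
  \prod_(i < n.*2) (1 - 'X^(i.+1)) ^+ gauss_exp i.+1 =
  odd_prod n ^+ 2 * qpoch 'X^2 n.
Proof.
elim: n => [|n IH]; first by rewrite /odd_prod /qpoch !big_ord0 expr1n mulr1.
rewrite doubleS !big_ord_recr /= IH qpochS /odd_prod big_ord_recr /=.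
rewrite /gauss_exp /= odd_double /= -exprM mul2n doubleS; ring.
Qed.

Lemma eqmodX_prod_1subXn N m n (e : nat -> nat) :
  (N <= m.+1)%N -> (m <= n)%N ->
  eqmodX N (\prod_(i < m) (1 - 'X^(i.+1)) ^+ e i)
           (\prod_(i < n) (1 - 'X^(i.+1)) ^+ e i : {poly R}).
Proof.
move=> le_Nm; elim: n => [|n IH]; first by rewrite leqn0 => /eqP ->.
rewrite leq_eqVlt => /orP [/eqP -> //|lt_mn].
rewrite big_ord_recr /= -[X in eqmodX _ X _]mulr1.
apply: eqmodXM; first exact: IH.
apply: eqmodX_sym; rewrite -[X in eqmodX _ _ X](expr1n _ (e n)); apply: eqmodX_exp.
by apply: eqmodX_1subXn; lia.
Qed.

Lemma coef_prod_gauss_exp m n : (n <= m)%N -> (forall x, x ^ 2 != n)%N ->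
  (\prod_(i < m) (1 - 'X^(i.+1)) ^+ gauss_exp i.+1 : {poly R})`_n = 0.
Proof.
move=> le_nm n_nsq.
have h M := @eqmodX_prod_1subXn n.+1 n M (gauss_exp \o succn) (leqnn _).
have /= <- // := h m le_nm n (ltnSn n).
(* Passing to [4(n+1)] factors gives the product that [eqmodX_gauss] controls through degree [n]. *)
have /= -> // := h n.+1.*2.*2 _ n (ltnSn n); last by lia.
rewrite prod_gauss_exp eqmodX_gauss // coef_sum big1 // => k _.
rewrite -signr_odd mulr_sign; case: (odd _); rewrite ?coefN coefXn.
- by rewrite eq_sym (negPf (n_nsq _)) oppr0.
- by rewrite eq_sym (negPf (n_nsq _)).
Qed.

End Gauss.

(** * The generating function *)

Section GeneratingFunction.

Variable R : comNzRingType.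

(** Expanding the product of geometric sums chooses a multiplicity in ['I_n.+1] for each colored
    part. *)
Lemma a_coef r s n :
  (a r s n)%:R =
  (\prod_(i < n) geomX R n.+1 i.+1 ^+ ncolors r s i.+1)`_n.
Proof.
have -> : \prod_(i < n) geomX R n.+1 i.+1 ^+ ncolors r s i.+1 =
          \prod_(u : colored_part r s n) geomX R n.+1 (part_size u).
  transitivity (\prod_(i < n) \prod_(c < ncolors r s i.+1) geomX R n.+1 i.+1).
    by apply: eq_bigr => i _; rewrite prodr_const card_ord.
  exact: (@sig_big_dep _ _ _ _ (fun i : 'I_n => 'I_(ncolors r s i.+1))
            predT (fun _ => predT) (fun i _ => geomX R n.+1 i.+1)).
rewrite /geomX bigA_distr_bigA coef_sum /a -sum1_card natr_sum big_mkcond /=.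
apply: eq_bigr => m _; rewrite inE prodrXr coefXn eq_sym.
by case: eqP.
Qed.

End GeneratingFunction.

(** By Frobenius, [Q ^+ p] is a polynomial in ['X^p]. *)
Lemma coef_exp_pchar p (Q : {poly 'F_p}) i : prime p -> ~~ (p %| i)%N ->
  (Q ^+ p)`_i = 0.
Proof.
move=> p_pr p_ndvd.
have pchar_p : p \in [pchar {poly 'F_p}] by rewrite pchar_poly pchar_Fp.
rewrite -(pFrobenius_autE pchar_p) -[Q]coefK poly_def rmorph_sum coef_sum big1 //.
move=> j _; rewrite /= pFrobenius_autE exprZn coefZ -exprM coefXn.
case: eqP => [ei|_]; last by rewrite mulr0.
by rewrite ei dvdn_mull in p_ndvd.
Qed.

Local Close Scope ring_scope.

Theorem theorem1p15 (p : nat) (hp : prime p) (hp5 : 5 <= p)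
    (r : nat) (hr : 1 <= r <= p - 1) (hnr : ~ quadratic_residue p r)
    (n k j : nat) (hjk : j <= k) :
  a (p * (k - j) + (p - 1)) (p * k + (p - 2)) (p * n + r) = 0 %[mod p].
Proof.
apply/eqP; rewrite mod0n -/(dvdn _ _) (dvdn_pcharf (pchar_Fp hp)) a_coef.
set N := p * n + r; set nc := ncolors _ _.
(* Chosen so that [c i * p = gauss_exp i + nc i]: [p(k+1) = 2 + (pk+p-2)] for odd [i],
   [p(k-j+1) = 1 + (p(k-j)+p-1)] for even [i]. *)
pose c i := if odd i then k.+1 else (k - j).+1.
(* [N - l] is congruent to [r], so it cannot be a square. *)
have nsq x l : p %| l -> l <= N -> x ^ 2 != N - l.
  move=> /dvdnP [m ->] le_m; apply/eqP => ex; apply: hnr; exists x.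
  rewrite ex /N; apply/eqP; rewrite -(eqn_modDr (m * p)) subnK //.
  by rewrite [r + _]addnC [p * n]mulnC !modnMDl.
pose Q : {poly 'F_p} := (\prod_(i < N) geomX _ N.+1 i.+1 ^+ c i.+1)%R.
pose P : {poly 'F_p} := (\prod_(i < N) (1 - 'X^(i.+1)) ^+ gauss_exp i.+1)%R.
have PQ : eqmodX N.+1 (P * Q ^+ p)%R
                      (\prod_(i < N) geomX 'F_p N.+1 i.+1 ^+ nc i.+1)%R.
  rewrite /P /Q -prodrXl -big_split /=; apply: eqmodX_prod => i _.
  have e : c i.+1 * p = gauss_exp i.+1 + nc i.+1.
    by rewrite /c /nc /gauss_exp /ncolors; case: (odd _); lia.
  (* The first [gauss_exp] copies of the geometric sum cancel the factor from [P]. *)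
  rewrite -exprM e exprD mulrA -exprMn -[X in eqmodX _ _ X]mul1r.
  apply: eqmodXM; last exact: eqmodX_refl.
  rewrite -[X in eqmodX _ _ X](expr1n _ (gauss_exp i.+1)).
  exact/eqmodX_exp/eqmodX_geom.
rewrite -PQ // coefM big1 // => l _.
(* [Q ^+ p] contributes only if [p] divides [N - l]; then [l] is not a square and the coefficient of
   [P] vanishes. *)
have [p_dvd|p_ndvd] := boolP (p %| N - l); last first.
  by rewrite coef_exp_pchar ?mulr0.
have le_l : l <= N by rewrite -ltnS ltn_ord.
rewrite /P coef_prod_gauss_exp ?mul0r // => x.
by rewrite -(subKn le_l) nsq // leq_subr.
Qed.
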